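(* Let $p\ge5$ be a prime with Legendre symbol $\left(\frac{-9}{p}\right)=-1$, and let $m\ge0$, $\alpha\ge0$, $n\ge0$ be integers. Then for every $i\in\{1,2,\dots,p-1\}$, $$\overline{S}_9^{\,8m+1}\big(12p^{2\alpha+2}n+(12i+5p)p^{2\alpha+1}\big)\equiv0\pmod{16}.$$
   Context: For $|q|<1$ and a positive integer $k$, write $f_k=\prod_{j\ge1}(1-q^{kj})$. For a positive integer $r$, $\overline{S}_9^{\,r}(n)$ (number of $9$-Schur overpartitions of $n$ with $r$-tuples) is defined by $\sum_{n\ge0}\overline{S}_9^{\,r}(n)q^n=\prod_{n\ge1}\frac{(1+q^{2n-1})^r(1-q^{9(2n-1)})^r}{(1+q^{9(2n-1)})^r(1-q^{2n-1})^r}=\frac{f_2^{3r}f_9^{2r}f_{36}^r}{f_1^{2r}f_4^rf_{18}^{3r}}$. *)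

(* Defs.v *)
(* The classical boolp file is used only to give the type of formal power
   series an equality and a choice structure. *)
From HB Require Import structures.
From mathcomp Require Import all_boot all_order all_algebra.
From mathcomp Require Import boolp.

Set Implicit Arguments.
Unset Strict Implicit.
Unset Printing Implicit Defensive.

Import Order.TTheory GRing.Theory Num.Theory.
Local Open Scope ring_scope.

Record fps (R : Type) := Fps { fcoef : nat -> R }.

Lemma fpsP (R : Type) (a b : fps R) :
  (forall n, fcoef a n = fcoef b n) -> a = b.
Proof. by case: a => f; case: b => g /= /funext ->. Qed.

HB.instance Definition _ (R : Type) := gen_eqMixin (fps R).
HB.instance Definition _ (R : Type) := gen_choiceMixin (fps R).

Section FpsRing.
Variable R : comNzRingType.
Implicit Types a b c : fps R.

Definition fps0 : fps R := Fps (fun _ => 0).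
Definition fps1 : fps R := Fps (fun n => (n == 0%N)%:R).
Definition fps_opp a : fps R := Fps (fun n => - fcoef a n).
Definition fps_add a b : fps R := Fps (fun n => fcoef a n + fcoef b n).
Definition fps_mul a b : fps R :=
  Fps (fun n => \sum_(i < n.+1) fcoef a i * fcoef b (n - i)).

Fact fps_addA : associative fps_add.
Proof. by move=> a b c; apply: fpsP => n /=; rewrite addrA. Qed.
Fact fps_addC : commutative fps_add.
Proof. by move=> a b; apply: fpsP => n /=; rewrite addrC. Qed.
Fact fps_add0 : left_id fps0 fps_add.
Proof. by move=> a; apply: fpsP => n /=; rewrite add0r. Qed.
Fact fps_addN : left_inverse fps0 fps_opp fps_add.
Proof. by move=> a; apply: fpsP => n /=; rewrite addNr. Qed.

HB.instance Definition _ :=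
  GRing.isZmodule.Build (fps R) fps_addA fps_addC fps_add0 fps_addN.

Definition fps_trunc (N : nat) a : {poly R} := \poly_(i < N) fcoef a i.

Lemma fcoef_mul_trunc N a b n : (n < N)%N ->
  fcoef (fps_mul a b) n = (fps_trunc N a * fps_trunc N b)`_n.
Proof.
move=> ltnN; rewrite coefM /=; apply: eq_bigr => i _.
have lei : (i <= n)%N by rewrite -ltnS.
by rewrite !coef_poly (leq_ltn_trans lei ltnN) (leq_ltn_trans (leq_subr _ _) ltnN).
Qed.

Fact fps_mulC : commutative fps_mul.
Proof.
by move=> a b; apply: fpsP => n; rewrite !(@fcoef_mul_trunc n.+1) // mulrC.
Qed.

Fact fps_mulA : associative fps_mul.
Proof.
move=> a b c; apply: fpsP => n.
transitivity ((fps_trunc n.+1 a * (fps_trunc n.+1 b * fps_trunc n.+1 c))`_n).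
  rewrite coefM /=; apply: eq_bigr => i _.
  by rewrite coef_poly ltn_ord -(@fcoef_mul_trunc n.+1) // ltnS leq_subr.
rewrite mulrA coefM /=; apply: eq_bigr => i _.
by rewrite -(@fcoef_mul_trunc n.+1) // coef_poly ltnS leq_subr.
Qed.

Fact fps_mul1 : left_id fps1 fps_mul.
Proof.
move=> a; apply: fpsP => n /=; rewrite big_ord_recl /= mul1r subn0.
by rewrite big1 ?addr0 // => i _; rewrite mul0r.
Qed.

Fact fps_mulDl : left_distributive fps_mul fps_add.
Proof.
move=> a b c; apply: fpsP => n /=; rewrite -big_split /=.
by apply: eq_bigr => i _; rewrite mulrDl.
Qed.

Fact fps_1neq0 : fps1 != 0 :> fps R.
Proof.
by apply/eqP => /(congr1 (fun a => fcoef a 0)) /= /eqP; rewrite oner_eq0.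
Qed.

HB.instance Definition _ :=
  GRing.Zmodule_isComNzRing.Build (fps R)
    fps_mulA fps_mulC fps_mul1 fps_mulDl fps_1neq0.

Lemma fcoef0 n : fcoef (0 : fps R) n = 0. Proof. by []. Qed.
Lemma fcoef1 n : fcoef (1 : fps R) n = (n == 0%N)%:R. Proof. by []. Qed.
Lemma fcoefN a n : fcoef (- a) n = - fcoef a n. Proof. by []. Qed.
Lemma fcoefD a b n : fcoef (a + b) n = fcoef a n + fcoef b n.
Proof. by []. Qed.
Lemma fcoefM a b n :
  fcoef (a * b) n = \sum_(i < n.+1) fcoef a i * fcoef b (n - i).
Proof. by []. Qed.

Definition fpsX : fps R := Fps (fun n => (n == 1%N)%:R).

Lemma fcoefXn k n : fcoef (fpsX ^+ k) n = (n == k)%:R.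
Proof.
elim: k n => [|k IHk] n; first by rewrite expr0 fcoef1.
rewrite exprS fcoefM; case: n => [|n].
  by rewrite big_ord1 /= mul0r.
rewrite !big_ord_recl /= mul0r add0r mul1r subSS subn0 IHk eqSS.
by rewrite big1 ?addr0 // => i _; rewrite mul0r.
Qed.

(* The infinite product F_1 F_2 F_3 ... .  It is meant for factors with
   F_j = 1 + O(q^j), for which the coefficient of q^n of the partial products
   F_1 ... F_N does not depend on N >= n; see fps_prodE. *)
Definition fps_prod (F : nat -> fps R) : fps R :=
  Fps (fun n => fcoef (\prod_(1 <= j < n.+1) F j) n).

Definition fps_is1 (k : nat) a := forall n, (n < k)%N -> fcoef a n = fcoef 1 n.

Lemma fcoef_mul_is1 k a b n :
  fps_is1 k b -> (n < k)%N -> fcoef (a * b) n = fcoef a n.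
Proof.
move=> b1 ltnk; rewrite -[in RHS](mulr1 a) !fcoefM; apply: eq_bigr => i _.
by rewrite b1 // (leq_ltn_trans (leq_subr _ _) ltnk).
Qed.

Lemma fps_prodE (F : nat -> fps R) n N :
  (forall j, (0 < j)%N -> fps_is1 j (F j)) -> (n <= N)%N ->
  fcoef (fps_prod F) n = fcoef (\prod_(1 <= j < N.+1) F j) n.
Proof.
move=> F1 /subnKC <-; elim: (N - n)%N => [|d IHd]; first by rewrite addn0.
rewrite addnS big_nat_recr // (@fcoef_mul_is1 (n + d).+1) //; first exact: F1.
by rewrite ltnS leq_addr.
Qed.

Lemma fps_is1_1 k : fps_is1 k 1. Proof. by []. Qed.

Lemma fps_is1M k a b : fps_is1 k a -> fps_is1 k b -> fps_is1 k (a * b).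
Proof. by move=> a1 b1 n ltnk; rewrite (fcoef_mul_is1 _ b1) ?a1. Qed.

Lemma fps_is1X k a r : fps_is1 k a -> fps_is1 k (a ^+ r).
Proof.
by move=> a1; elim: r => [|r IHr] //; rewrite exprS; apply: fps_is1M.
Qed.

Lemma fps_is1_1D k l : (k <= l)%N -> fps_is1 k (1 + fpsX ^+ l).
Proof.
move=> lekl n ltnk; rewrite fcoefD fcoefXn.
by rewrite ltn_eqF ?addr0 // (leq_trans ltnk).
Qed.

Lemma fps_is1_1B k l : (k <= l)%N -> fps_is1 k (1 - fpsX ^+ l).
Proof.
move=> lekl n ltnk; rewrite fcoefD fcoefN fcoefXn.
by rewrite ltn_eqF ?subr0 // (leq_trans ltnk).
Qed.

End FpsRing.

Arguments fpsX {R}.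

Section FpsUnitRing.
Variable R : comUnitRingType.
Implicit Types a b : fps R.

(* The first n coefficients of the inverse of a, from the recursion
   b_n = - a_0^-1 * \sum_(i < n) b_i a_(n-i). *)
Fixpoint fps_inv_seq a (n : nat) : seq R :=
  if n is k.+1 then
    let s := fps_inv_seq a k in
    rcons s ((fcoef a 0)^-1 *
             ((k == 0%N)%:R - \sum_(i < k) s`_i * fcoef a (k - i)))
  else [::].

Definition fps_unit : pred (fps R) := fun a => fcoef a 0 \is a GRing.unit.
Definition fps_inv a : fps R :=
  if fps_unit a then Fps (fun n => (fps_inv_seq a n.+1)`_n) else a.

Lemma size_fps_inv_seq a n : size (fps_inv_seq a n) = n.
Proof. by elim: n => //= n IHn; rewrite size_rcons IHn. Qed.

Lemma nth_fps_inv_seq a n i : (i < n)%N ->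
  (fps_inv_seq a n)`_i = (fps_inv_seq a i.+1)`_i.
Proof.
elim: n => // n IHn; rewrite ltnS leq_eqVlt => /orP[/eqP -> //|ltin].
by rewrite [LHS]/= nth_rcons size_fps_inv_seq ltin IHn.
Qed.

Fact fps_mulVr : {in fps_unit, left_inverse 1 fps_inv *%R}.
Proof.
move=> a ua; apply: fpsP => n.
have {}ua : fps_unit a by [].
rewrite fcoefM fcoef1 /fps_inv ua big_ord_recr /= subnn.
rewrite nth_rcons size_fps_inv_seq ltnn eqxx mulrC mulVKr //.
under eq_bigr => i _ do
  rewrite -[rcons _ _]/(fps_inv_seq a i.+1) -(nth_fps_inv_seq a (ltn_ord i)).
by rewrite addrC subrK.
Qed.

Fact fps_unitPl a b : b * a = 1 -> fps_unit a.
Proof.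
move=> /(congr1 (fun c => fcoef c 0)); rewrite fcoefM big_ord1 fcoef1 => ba1.
by apply/unitrP; exists (fcoef b 0); rewrite ba1 mulrC ba1.
Qed.

Fact fps_inv_out : {in [predC fps_unit], fps_inv =1 id}.
Proof.
by move=> a /negbTE nua; rewrite /fps_inv -[fps_unit a]/(a \in fps_unit) nua.
Qed.

HB.instance Definition _ :=
  GRing.ComNzRing_hasMulInverse.Build (fps R) fps_mulVr fps_unitPl fps_inv_out.

Lemma fps_unitE a : (a \is a GRing.unit) = (fcoef a 0 \is a GRing.unit).
Proof. by []. Qed.

Lemma fps_is1_unit k a : (0 < k)%N -> fps_is1 k a -> a \is a GRing.unit.
Proof. by move=> k0 a1; rewrite fps_unitE a1 // fcoef1 eqxx unitr1. Qed.

Lemma fps_is1V k a : fps_is1 k a -> fps_is1 k a^-1.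
Proof.
case: k => [|k] a1 //.
have ua := fps_is1_unit (ltn0Sn k) a1.
by move=> n ltnk; rewrite -(fcoef_mul_is1 _ a1 ltnk) mulVr.
Qed.

End FpsUnitRing.

Local Notation q := (fpsX : fps int).

Definition schur9_factor (r n : nat) : fps int :=
  ((1 + q ^+ (2 * n - 1)) ^+ r * (1 - q ^+ (9 * (2 * n - 1))) ^+ r) /
  ((1 + q ^+ (9 * (2 * n - 1))) ^+ r * (1 - q ^+ (2 * n - 1)) ^+ r).

Definition schur9_gf (r : nat) : fps int := fps_prod (schur9_factor r).

Definition schur9_overpartitions (r n : nat) : int := fcoef (schur9_gf r) n.

Lemma schur9_factor_is1 r n : (0 < n)%N -> fps_is1 n (schur9_factor r n).
Proof.
move=> n0; have le1 : (n <= 2 * n - 1)%N.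
  by rewrite mul2n -addnn -addnBA // leq_addr.
have le9 : (n <= 9 * (2 * n - 1))%N by rewrite (leq_trans le1) // leq_pmull.
apply: fps_is1M; last apply: fps_is1V; apply: fps_is1M; apply: fps_is1X;
  by [apply: fps_is1_1D | apply: fps_is1_1B].
Qed.

Lemma schur9_gf_limit r n N : (n <= N)%N ->
  schur9_overpartitions r n = fcoef (\prod_(1 <= j < N.+1) schur9_factor r j) n.
Proof. by apply: fps_prodE; apply: schur9_factor_is1. Qed.

(* Only meaningful for p prime: 'F_p is then Z/pZ. *)
Definition legendre (a : int) (p : nat) : int :=
  if a%:~R == 0 :> 'F_p then 0
  else if [exists x : 'F_p, x ^+ 2 == a%:~R] then 1 else -1.

(* Main.v *)
(* A theta identity of Gauss turns (prod_n (1 + z q^(c(2n-1)))/(1 - z q^(c(2n-1)))),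
   for z = 1 or -1, into theta(z, c) / theta(-1, 2c), where theta(z, c) is the sum of
   z^k q^(c k^2) over all integers k.  Hence the generating function for r-tuples is
   (Y / V)^r with Y = theta(1, 1) theta(-1, 9) and V = theta(-1, 2) theta(-1, 18).
   Eighth powers of series 1 + 2x are 1 modulo 16, so for r = 8m+1 only Y / V matters,
   and 1/V = 1 - 2v + 4v^2 - 8v^3 modulo 16 for V = 1 + 2v.  Sorting the terms by the
   residue of their exponents modulo 6, the coefficient at N = 5 mod 6 is, modulo 16,
   8 times the coefficient of a product of two series supported on squares.  It vanishes
   because N has an odd power of a prime p for which -1 is not a square, so that N is
   not a sum of two squares. *)
Require Import Defs.
From mathcomp Require Import all_boot all_order all_algebra.
From mathcomp Require Import zify ring.

Set Implicit Arguments.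
Unset Strict Implicit.
Unset Printing Implicit Defensive.

Import GRing.Theory.
Local Open Scope ring_scope.

(** * Power series modulo powers of q *)

Section FpsCongruence.
Variable R : comNzRingType.
Implicit Types a b c d : fps R.

Lemma fcoef_sum I r (Q : pred I) (F : I -> fps R) n :
  fcoef (\sum_(i <- r | Q i) F i) n = \sum_(i <- r | Q i) fcoef (F i) n.
Proof. exact: (big_morph (fun a => fcoef a n)). Qed.

Lemma fcoefMn a k n : fcoef (a *+ k) n = fcoef a n *+ k.
Proof. by elim: k => [|k IHk]; rewrite ?mulr0n // !mulrS fcoefD IHk. Qed.

Lemma fcoefMz a z n : fcoef (a *~ z) n = fcoef a n *~ z.
Proof. by case: z => k; rewrite ?NegzE ?mulrNz ?fcoefN -?pmulrn fcoefMn. Qed.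

Lemma fcoefXnM k a n :
  fcoef (fpsX ^+ k * a) n = if (n < k)%N then 0 else fcoef a (n - k).
Proof.
rewrite fcoefM; case: ltnP => [ltnk|lekn].
  rewrite big1 // => i _; rewrite fcoefXn ltn_eqF ?mul0r //.
  by rewrite (leq_trans (ltn_ord i)).
have ltk : (k < n.+1)%N by rewrite ltnS.
rewrite (bigD1 (Ordinal ltk)) //= fcoefXn eqxx mul1r big1 ?addr0 // => i neq.
by rewrite fcoefXn -(inj_eq val_inj) /= in neq *; rewrite (negbTE neq) mul0r.
Qed.

(** The indeterminate is not a unit, so its powers are cancelled by injectivity instead of
    division. *)
Lemma fpsXn_inj k : injective (fun a => fpsX ^+ k * a).
Proof.
move=> a b eqab; apply: fpsP => n.
have /(congr1 (fun c => fcoef c (k + n))) := eqab.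
by rewrite !fcoefXnM ltnNge leq_addr addKn.
Qed.

(** Congruence modulo q^N: at this precision infinite products can be replaced by partial
    products. *)
Definition fps_eqm N a b := forall n, (n < N)%N -> fcoef a n = fcoef b n.

Lemma fps_eqm_refl N a : fps_eqm N a a. Proof. by []. Qed.

Lemma fps_eqm_sym N a b : fps_eqm N a b -> fps_eqm N b a.
Proof. by move=> ab n ltn; rewrite ab. Qed.

Lemma fps_eqm_trans N a b c : fps_eqm N a b -> fps_eqm N b c -> fps_eqm N a c.
Proof. by move=> ab bc n ltn; rewrite ab ?bc. Qed.

Lemma fps_eqm_leq M N a b : (M <= N)%N -> fps_eqm N a b -> fps_eqm M a b.
Proof. by move=> leMN ab n ltn; rewrite ab // (leq_trans ltn). Qed.

Lemma fps_eqmD N a b c d :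
  fps_eqm N a b -> fps_eqm N c d -> fps_eqm N (a + c) (b + d).
Proof. by move=> ab cd n ltn; rewrite !fcoefD ab ?cd. Qed.

Lemma fps_eqmM N a b c d :
  fps_eqm N a b -> fps_eqm N c d -> fps_eqm N (a * c) (b * d).
Proof.
move=> ab cd n ltn; rewrite !fcoefM; apply: eq_bigr => i _.
by rewrite ab ?cd //; have := ltn_ord i; lia.
Qed.

Lemma fps_eqmX N a b k : fps_eqm N a b -> fps_eqm N (a ^+ k) (b ^+ k).
Proof.
by move=> ab; elim: k => // k IHk; rewrite !exprS; apply: fps_eqmM.
Qed.

Lemma fps_eqm_sum N I r (Q : pred I) (F G : I -> fps R) :
  (forall i, Q i -> fps_eqm N (F i) (G i)) ->
  fps_eqm N (\sum_(i <- r | Q i) F i) (\sum_(i <- r | Q i) G i).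
Proof.
by move=> FG n ltn; rewrite !fcoef_sum; apply: eq_bigr => i Qi; apply: FG.
Qed.

Lemma fps_eqmXnM N k a b :
  fps_eqm N a b -> fps_eqm (k + N) (fpsX ^+ k * a) (fpsX ^+ k * b).
Proof.
move=> ab n ltn; rewrite !fcoefXnM; case: ltnP => // lekn.
by apply: ab; lia.
Qed.

Lemma fps_eqmP a b : (forall N, fps_eqm N a b) -> a = b.
Proof. by move=> ab; apply: fpsP => n; apply: (ab n.+1). Qed.

Lemma fps_is1_prod N I (r : seq I) (Q : pred I) (F : I -> fps R) :
  (forall i, Q i -> fps_is1 N (F i)) -> fps_is1 N (\prod_(i <- r | Q i) F i).
Proof. by move=> F1; apply: big_ind => //; apply: fps_is1M. Qed.

End FpsCongruence.

(** * Gaussian binomial coefficients and the q-binomial theorem *)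

Section QBinomial.
Variable R : comNzRingType.
Implicit Types Q a b : R.

(** Gaussian binomial coefficients by the q-Pascal rule, which involves no division and so makes
    sense in every commutative ring. *)
Fixpoint qbinomial Q n k : R :=
  match n, k with
  | _, 0 => 1
  | 0, _.+1 => 0
  | m.+1, l.+1 => qbinomial Q m l + Q ^+ l.+1 * qbinomial Q m l.+1
  end.

(** The q-Pochhammer symbol (Q; Q)_n. *)
Definition qpoch Q n : R := \prod_(1 <= j < n.+1) (1 - Q ^+ j).

Lemma qpoch0 Q : qpoch Q 0 = 1. Proof. by rewrite /qpoch big_nil. Qed.

Lemma qpochS Q n : qpoch Q n.+1 = qpoch Q n * (1 - Q ^+ n.+1).
Proof. by rewrite /qpoch big_nat_recr. Qed.

Lemma qpoch_split Q m n : (m <= n)%N ->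
  qpoch Q n = qpoch Q m * \prod_(m.+1 <= j < n.+1) (1 - Q ^+ j).
Proof. by move=> lemn; rewrite /qpoch -big_cat_nat. Qed.

Lemma qbinomial0 Q n : qbinomial Q n 0 = 1. Proof. by case: n. Qed.

Lemma qbinomial_small Q n k : (n < k)%N -> qbinomial Q n k = 0.
Proof.
elim: n k => [|n IHn] [|k] //= ltnk.
by rewrite !IHn ?mulr0 ?addr0 // ltnW.
Qed.

(** Induction on k + l; the q-Pascal rule reduces the step to 1 - Q^(k+l+2) = (1 - Q^(k+1)) +
    Q^(k+1) (1 - Q^(l+1)). *)
Lemma qbinomial_poch Q k l :
  qbinomial Q (k + l) k * qpoch Q k * qpoch Q l = qpoch Q (k + l).
Proof.
elim: {k l}(k + l)%N {-2}k {-2}l (erefl (k + l)%N) => [|n IHn] [|k] [|l] // eqn.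
- by rewrite qbinomial0 !qpoch0 !mulr1.
- by rewrite qbinomial0 qpoch0 !mul1r.
- rewrite addn0 /= (@qbinomial_small Q k k.+1) // mulr0 addr0 qpoch0 mulr1.
  have := IHn k 0%N; rewrite !addn0 qpoch0 mulr1 => IH.
  by rewrite qpochS mulrA IH //; lia.
rewrite addSn [qbinomial _ _ _]/= !qpochS.
have IH1 := IHn k l.+1 ltac:(lia).
have IH2 := IHn k.+1 l ltac:(lia).
rewrite addSnnS in IH2; rewrite !qpochS in IH1 IH2.
have ->: Q ^+ (k + l.+1).+1 = Q ^+ k.+1 * Q ^+ l.+1.
  by rewrite -exprD addSn.
rewrite [RHS]mulrBr mulr1.
set g1 := qbinomial _ _ k in IH1 *; set g2 := qbinomial _ _ k.+1 in IH2 *.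
rewrite [qpoch _ (k + l.+1) * _]mulrA -{1}IH1.
transitivity (g1 * qpoch Q k * (qpoch Q l * (1 - Q ^+ l.+1)) * (1 - Q ^+ k.+1) +
  Q ^+ k.+1 * (g2 * (qpoch Q k * (1 - Q ^+ k.+1)) * qpoch Q l) * (1 - Q ^+ l.+1)).
  ring.
rewrite IH2 IH1; ring.
Qed.

(** Splitting off the factor a + b leaves the same product with b Q in place of b. The form
    homogeneous in a and b lets a power of q stand for a, without inverses. *)
Lemma qbinomial_theorem Q a b n :
  \prod_(j < n) (a + b * Q ^+ j) =
  \sum_(k < n.+1) a ^+ (n - k) * b ^+ k * Q ^+ 'C(k, 2) * qbinomial Q n k.
Proof.
elim: n b => [|n IHn] b; first by rewrite big_ord0 big_ord1 !mulr1.
rewrite big_ord_recl expr0 mulr1.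
under eq_bigr => j _ do rewrite /= exprS mulrA.
rewrite IHn mulrDl [in RHS]big_ord_recl /= !mulr1 subn0.
under [in RHS]eq_bigr => k _ do rewrite /bump add1n /= subSS mulrDr.
rewrite big_split /= addrA addrAC; congr (_ + _).
  rewrite [in LHS]big_ord_recl /= subn0 !expr0 qbinomial0 !mulr1 mulrDr.
  rewrite -exprS; congr (_ + _).
  rewrite [in RHS]big_ord_recr /= (@qbinomial_small Q n n.+1) // !mulr0 addr0.
  rewrite mulr_sumr; apply: eq_bigr => k _; rewrite /bump add1n.
  have -> : (n - k = (n - k.+1).+1)%N by have := ltn_ord k; lia.
  rewrite exprMn !exprS; ring.
rewrite mulr_sumr; apply: eq_bigr => k _.
by rewrite binS bin1 exprMn !exprS exprD; ring.
Qed.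

End QBinomial.

Arguments fcoef : simpl never.

Local Notation q := (fpsX : fps int).

(** * Theta series and the finite Jacobi triple product *)

Lemma prod_pair_ends (R : comNzRingType) N (F : nat -> R) :
  \prod_(j < 2 * N) F j = \prod_(j < N) (F j * F (2 * N - j.+1)%N).
Proof.
rewrite mul2n -addnn big_split_ord /= big_split /=; congr (_ * _).
rewrite (reindex_inj rev_ord_inj) /=; apply: eq_bigr => j _; congr F.
by have := ltn_ord j; lia.
Qed.

(** Bounding k by n loses nothing when c > 0, and the free weight [w] allows dissections by
    restricting k. *)
Definition theta_tail (c : nat) (w : nat -> int) : fps int :=
  Fps (fun n => \sum_(1 <= k < n.+1 | (c * k ^ 2)%N == n) w k).

Lemma fcoef_theta_tail c w n :
  fcoef (theta_tail c w) n = \sum_(1 <= k < n.+1 | (c * k ^ 2)%N == n) w k.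
Proof. by []. Qed.

(* theta z c is the bilateral sum of z^k q^(c k^2) only when z = 1 or -1: then the
   terms for k and -k agree. *)
Definition theta (z : int) (c : nat) : fps int :=
  1 + theta_tail c (fun k => z ^+ k) *+ 2.

Lemma theta_tail_trunc c w M : (0 < c)%N ->
  fps_eqm M.+1 (theta_tail c w)
    (\sum_(1 <= k < M.+1) (w k)%:~R * q ^+ (c * k ^ 2)).
Proof.
move=> c0 n ltn; rewrite fcoef_sum fcoef_theta_tail.
rewrite [RHS](@big_cat_nat _ _ _ n.+1) //= [X in _ + X]big_nat_cond.
rewrite [X in _ + X]big1 ?addr0 => [|k /andP[/andP[ltk _] _]]; last first.
  rewrite mulrzl fcoefMz fcoefXn ltn_eqF ?mul0rz //.
  by rewrite expnS; nia.
rewrite big_mkcond; apply: eq_bigr => k _.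
by rewrite mulrzl fcoefMz fcoefXn eq_sym; case: eqP => _; rewrite ?mul0rz ?intz.
Qed.

Lemma sum_arith N : (\sum_(j < N) (2 * j + 2 * N - 1) = 3 * N ^ 2 - 2 * N)%N.
Proof.
(* The number M of terms is separated from N for the induction; N > 0 keeps the truncated
   subtraction exact. *)
suff sumE M : (0 < N)%N ->
    (\sum_(j < M) (2 * j + 2 * N - 1) + 2 * M = M ^ 2 + 2 * N * M)%N.
  by case: N sumE => [|N] sumE; rewrite ?big_ord0 //; have := sumE N.+1 isT; rewrite !expnS; nia.
move=> N0; elim: M => [|M IHM]; first by rewrite big_ord0; lia.
by rewrite big_ord_recr /=; move: (\sum_(i < M) _)%N IHM => S IHM; nia.
Qed.

Lemma bin2_double k : ('C(k, 2) * 2 = k * k.-1)%N.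
Proof. by elim: k => // k IHk; rewrite binS bin1; nia. Qed.

(** Completing the square: (2N-1)(2N-k) + k(k-1) = 3N^2 - 2N + (k-N)^2. The sum of the two truncated
    differences is |k - N|. *)
Lemma theta_exponent N k : (0 < N)%N -> (k <= 2 * N)%N ->
  ((2 * N - 1) * (2 * N - k) + 2 * 'C(k, 2) =
   3 * N ^ 2 - 2 * N + (k - N + (N - k)) ^ 2)%N.
Proof.
case: N => // N _ lek; rewrite [(2 * 'C(k, 2))%N]mulnC bin2_double.
have -> : (2 * N.+1 - 1 = 2 * N + 1)%N by lia.
have -> : (3 * N.+1 ^ 2 - 2 * N.+1 = 3 * N ^ 2 + 4 * N + 1)%N.
  by rewrite !expnS expn0; lia.
have [lekN|ltNk] := leqP k N.
  have [d ->] : exists d, N = (k + d)%N by exists (N - k)%N; lia.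
  have -> : (2 * (k + d).+1 - k = k + 2 * d + 2)%N by lia.
  have -> : (k - (k + d).+1 + ((k + d).+1 - k) = d.+1)%N by lia.
  by case: k {lek lekN} => [|k]; rewrite /= !expnS !expn0; lia.
have [d kE] : exists d, k = (N.+1 + d)%N by exists (k - N.+1)%N; lia.
have [e NE] : exists e, N.+1 = (d + e)%N by exists (N.+1 - d)%N; lia.
have -> : (2 * N.+1 - k = e)%N by lia.
have -> : (k - N.+1 + (N.+1 - k) = d)%N by lia.
have {NE}-> : e = (N.+1 - d)%N by lia.
have : ((2 * N + 1) * d <= (2 * N + 1) * N.+1)%N by rewrite leq_mul2l; lia.
rewrite kE /= !expnS !expn0 mulnBr; lia.
Qed.

Lemma fps_is1_qpoch_tail e a b : (0 < e)%N ->
  fps_is1 (e * a) (\prod_(a <= j < b) (1 - (q ^+ e) ^+ j)).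
Proof.
move=> e0; rewrite big_nat_cond; apply: fps_is1_prod => j /andP[/andP[leaj _] _].
by rewrite -exprM; apply: fps_is1_1B; rewrite leq_mul2l leaj orbT.
Qed.

Lemma qpoch_unit e n : (0 < e)%N -> qpoch (q ^+ e) n \is a GRing.unit.
Proof.
move=> e0; apply: (@fps_is1_unit _ e) => //.
by rewrite -[X in fps_is1 X]muln1; apply: fps_is1_qpoch_tail.
Qed.

(** Since [g] is a quotient of Pochhammer symbols, [g * qpoch (q ^+ e) M] is the product of the
    factors with b < j <= 2M and of those with a < j <= M. All of them are 1 + O(q^(e(a+1))). *)
Lemma fps_is1_qbinomial e M a b (g : fps int) : (0 < e)%N ->
  (a <= M)%N -> (M <= b)%N -> (b <= 2 * M)%N ->
  g * qpoch (q ^+ e) b * qpoch (q ^+ e) a = qpoch (q ^+ e) (2 * M) ->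
  fps_is1 (e * a.+1) (g * qpoch (q ^+ e) M).
Proof.
move=> e0 leaM leMb leb2M eqg.
pose tl m n := \prod_(m.+1 <= j < n.+1) (1 - (q ^+ e) ^+ j).
have -> : g * qpoch (q ^+ e) M = tl b (2 * M)%N * tl a M.
  apply: (mulIr (qpoch_unit b e0)); apply: (mulIr (qpoch_unit a e0)).
  transitivity (g * qpoch (q ^+ e) b * qpoch (q ^+ e) a * qpoch (q ^+ e) M).
    by ring.
  rewrite eqg (qpoch_split _ leb2M) (qpoch_split _ leaM) -!/(tl _ _); ring.
apply: fps_is1M; last exact: fps_is1_qpoch_tail.
move=> n ltn; apply: (@fps_is1_qpoch_tail e b.+1 (2 * M).+1 e0 n).
by rewrite (leq_trans ltn) // leq_mul2l; lia.
Qed.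

Section ThetaProduct.
Variables (z : int) (c : nat).
Hypotheses (zz : z * z = 1) (c0 : (0 < c)%N).
Let Z : fps int := z%:~R.
Let y := q ^+ c.

Let ZZ : Z * Z = 1. Proof. by rewrite -rmorphM zz. Qed.

Let Zpar k l : odd k = odd l -> Z ^+ k = Z ^+ l.
Proof.
have Zodd n : Z ^+ n = Z ^+ (odd n).
  by rewrite -{1}(odd_double_half n) exprD -mul2n exprM expr2 ZZ expr1n mulr1.
by rewrite (Zodd k) (Zodd l) => ->.
Qed.

Let dist k M := (k - M + (M - k))%N.

(** The index [k] stands for the integer k - M, of absolute value [dist k M]. The exponent k + M of
    Z has the same parity, which is all that matters as Z^2 = 1. *)
Lemma theta_trunc M : fps_eqm M.+1 (theta z c)
  (\sum_(k < (2 * M).+1) Z ^+ (k + M) * y ^+ (dist k M ^ 2)).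
Proof.
have -> : \sum_(k < (2 * M).+1) Z ^+ (k + M) * y ^+ (dist k M ^ 2) =
    1 + (\sum_(1 <= k < M.+1) ((z ^+ k)%:~R : fps int) * q ^+ (c * k ^ 2)) *+ 2.
  rewrite -(big_mkord xpredT (fun k => Z ^+ (k + M) * y ^+ (dist k M ^ 2))).
  rewrite (@big_cat_nat _ _ _ M) //=; last by lia.
  rewrite (@big_cat_nat _ _ _ M.+1 M) //=; last by lia.
  rewrite big_nat1 /dist !subnn expr0 mulr1 addrCA mulr2n.
  rewrite (@Zpar _ 0%N) ?expr0; last by rewrite addnn odd_double.
  congr (_ + (_ + _)).
    rewrite big_nat_rev /= big_add1 /= !big_mkord; apply: eq_bigr => k _.
    rewrite rmorphXn /= -/Z add0n /y -exprM; congr (_ * _ ^+ (_ * _)).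
      by apply: Zpar; have := ltn_ord k; lia.
    by congr (_ ^ 2)%N; have := ltn_ord k; lia.
  rewrite -{1}[M.+1]add0n big_addn !big_add1 /= !big_mkord.
  have -> : ((2 * M).+1 - M.+1 = M)%N by lia.
  apply: eq_bigr => k _.
  rewrite rmorphXn /= -/Z /y -exprM; congr (_ * _ ^+ (_ * _)).
    by apply: Zpar; lia.
  by congr (_ ^ 2)%N; lia.
apply: fps_eqmD => // n ltn; rewrite !fcoefMn.
by rewrite (theta_tail_trunc _ c0 ltn).
Qed.

Let u j := y ^+ (2 * j - 1).

(* The q-binomial theorem with q^2 for q, applied to the product of the factors
   y^(2M-1) + z y^(2j); the factors for j and 2M-1-j pair up, which avoids negative
   powers of q. *)
Lemma theta_finite_product M :
  \prod_(1 <= j < M.+1) (1 + Z * u j) ^+ 2 =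
  \sum_(k < (2 * M).+1) Z ^+ (k + M) * y ^+ (dist k M ^ 2) *
     qbinomial (y ^+ 2) (2 * M) k.
Proof.
case: M => [|M]; first by rewrite big_nil big_ord1 !mulr1.
set N := M.+1; have := qbinomial_theorem (y ^+ 2) (y ^+ (2 * N - 1)) Z (2 * N).
(* The factors for j and 2N-1-j multiply to Z y^(2j+2N-1) (1 + Z u_(N-j))^2. The surplus Z
   y^(2j+2N-1), taken over all j < N, is put on both sides; it is cancellable. *)
move=> eqq; apply: (@fpsXn_inj _ (c * \sum_(j < N) (2 * j + 2 * N - 1))).
rewrite exprM -/y; apply: (can_inj (mulKr (x := Z ^+ N) _)).
  by apply/unitrP; exists (Z ^+ N); rewrite -exprMn ZZ expr1n.
transitivity (\prod_(j < 2 * N) (y ^+ (2 * N - 1) + Z * (y ^+ 2) ^+ j)).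
  rewrite (prod_pair_ends _ (fun j => y ^+ (2 * N - 1) + Z * (y ^+ 2) ^+ j)).
  rewrite big_add1 /= big_nat_rev /= big_mkord.
  have -> : Z ^+ N = \prod_(j < N) Z by rewrite prodr_const card_ord.
  rewrite -prodrXr -!big_split /=; apply: eq_bigr => j _; have ltj := ltn_ord j.
  rewrite -!(exprM y) add0n /u.
  have -> : (2 * j + 2 * N - 1 = 2 * j + (2 * N - 1))%N by lia.
  have -> : (2 * (2 * N - j.+1) = (2 * (N - j.+1).+1 - 1) + (2 * N - 1))%N by lia.
  have {2}-> : (2 * N - 1 = 2 * j + (2 * (N - j.+1).+1 - 1))%N by lia.
  rewrite !exprD expr2; set A := y ^+ (2 * j); set B := y ^+ (2 * N - 1).
  set C := y ^+ _; ring: ZZ.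
rewrite eqq !mulr_sumr; apply: eq_bigr => k _; have ltk := ltn_ord k.
have eZ : Z ^+ N * Z ^+ (k + N) = Z ^+ k by rewrite -exprD; apply: Zpar; lia.
have ey : y ^+ (2 * N - 1) ^+ (2 * N - k) * (y ^+ 2) ^+ 'C(k, 2) =
    y ^+ (\sum_(j < N) (2 * j + 2 * N - 1)) * y ^+ (dist k N ^ 2).
  rewrite -!(exprM y) -!exprD sum_arith; congr (y ^+ _); exact: theta_exponent.
rewrite [LHS](_ : _ = y ^+ (2 * N - 1) ^+ (2 * N - k) * (y ^+ 2) ^+ 'C(k, 2) *
  Z ^+ k * qbinomial (y ^+ 2) (2 * N) k); last by rewrite (mulrAC _ (Z ^+ k)).
by rewrite ey -eZ; ring.
Qed.

(** In the finite form the k-th term, with d = |k - M|, carries a Gaussian binomial. Multiplied by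
    [qpoch (y ^+ 2) M], this becomes 1 + O(q^(2c(a+1))) with a = min(k, 2M-k) = M - d. So the error
    in that term starts at exponent c(d^2 + 2(M-d+1)) = c((d-1)^2 + 2M + 1) > M. *)
Lemma theta_product M : fps_eqm M.+1 (theta z c)
  (\prod_(1 <= j < M.+1) ((1 - y ^+ (2 * j)) * (1 + Z * u j) ^+ 2)).
Proof.
apply: (fps_eqm_trans (@theta_trunc M)).
have -> : \prod_(1 <= j < M.+1) ((1 - y ^+ (2 * j)) * (1 + Z * u j) ^+ 2) =
  qpoch (y ^+ 2) M * \prod_(1 <= j < M.+1) (1 + Z * u j) ^+ 2.
  rewrite big_split /=; congr (_ * _).
  by apply: eq_bigr => j _; rewrite exprM.
rewrite theta_finite_product mulr_sumr.
apply: fps_eqm_sum => k _; have ltk := ltn_ord k.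
rewrite [X in fps_eqm _ _ X]mulrC -!mulrA; apply: fps_eqmM => //.
rewrite /y -!exprM -[X in fps_eqm _ X _]mulr1.
set d := dist k M.
set g := qbinomial _ _ _ * _.
pose a := minn k (2 * M - k); pose b := maxn k (2 * M - k).
have g1 : fps_is1 (c * 2 * a.+1) g.
  apply: (@fps_is1_qbinomial _ _ _ b); try (rewrite /a /b; lia).
  have := qbinomial_poch (q ^+ (c * 2)) k (2 * M - k).
  rewrite subnKC // /a /b; case: leqP => _ // eqk.
  by rewrite mulrAC.
apply: (@fps_eqm_leq _ _ (c * d ^ 2 + c * 2 * a.+1)); last first.
  by apply: fps_eqmXnM; apply: fps_eqm_sym.
have dle : (2 * d <= d ^ 2 + 1)%N by have [+ _] := nat_Cauchy 1 d; rewrite mul1n exp1n; lia.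
have : (M < d ^ 2 + 2 * a.+1)%N by move: dle; rewrite /d /dist /a; lia.
by move=> ltM; rewrite -mulnA -mulnDr (leq_trans ltM) // leq_pmull.
Qed.

End ThetaProduct.

(** * Quotients of theta series and the generating function *)

Lemma prod_even_odd (R : comNzRingType) M (F : nat -> R) :
  \prod_(1 <= j < (2 * M).+1) F j =
  \prod_(1 <= j < M.+1) (F (2 * j)%N * F (2 * j - 1)%N).
Proof.
elim: M => [|M IHM]; first by rewrite !big_nil.
have -> : (2 * M.+1 = (2 * M).+2)%N by lia.
do 2 rewrite big_nat_recr //=.
rewrite IHM [in RHS]big_nat_recr //= -mulrA; congr (_ * _).
by rewrite mulrC; congr (F _ * F _); lia.
Qed.

Definition odd_ratio (z : int) (c j : nat) : fps int :=
  (1 + z%:~R * q ^+ (c * (2 * j - 1))) / (1 - z%:~R * q ^+ (c * (2 * j - 1))).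

Lemma fps_is1_signed k l (z : int) : (k <= l)%N ->
  fps_is1 k (1 + z%:~R * q ^+ l).
Proof.
move=> lekl n ltnk; rewrite fcoefD mulrzl fcoefMz fcoefXn.
by rewrite ltn_eqF ?(leq_trans ltnk) // mul0rz addr0.
Qed.

Lemma signed_unit l (z : int) : (0 < l)%N -> 1 + z%:~R * q ^+ l \is a GRing.unit.
Proof. by move=> l0; apply: (fps_is1_unit l0); apply: fps_is1_signed. Qed.

(** With y = q^c and u = y^(2j-1), the product for theta(-1, 2c) has factors (1 - y^(4j)) (1 -
    u^2)^2. As Z^2 = 1, multiplying (1 - u^2)^2 by (1 + Zu)/(1 - Zu) gives (1 - u^2) (1 + Zu)^2. The
    factors 1 - y^(4j) and 1 - u^2 = 1 - y^(4j-2) together run over 1 - y^(2i) for i <= 2M, and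
    those with i > M lie beyond the precision. *)
Lemma theta_ratio (z : int) c M : z * z = 1 -> (0 < c)%N ->
  fps_eqm M.+1 (\prod_(1 <= j < M.+1) odd_ratio z c j * theta (-1) (2 * c))
    (theta z c).
Proof.
move=> zz c0; have c20 : (0 < 2 * c)%N by lia.
apply: (fps_eqm_trans (fps_eqmM (@fps_eqm_refl _ _ _)
  (@theta_product (-1) (2 * c) erefl c20 M))).
apply: fps_eqm_trans (fps_eqm_sym (@theta_product z c zz c0 M)).
set Z : fps int := z%:~R.
have ZZ : Z * Z = 1 by rewrite -rmorphM zz.
set y := q ^+ c.
have q2 : q ^+ (2 * c) = y ^+ 2 by rewrite mulnC exprM.
have -> : \prod_(1 <= j < M.+1) odd_ratio z c j *
    \prod_(1 <= j < M.+1) ((1 - (q ^+ (2 * c)) ^+ (2 * j)) *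
       (1 + (-1)%:~R * (q ^+ (2 * c)) ^+ (2 * j - 1)) ^+ 2) =
    \prod_(1 <= j < M.+1) (1 + Z * y ^+ (2 * j - 1)) ^+ 2 *
    qpoch (y ^+ 2) (2 * M).
  rewrite /qpoch prod_even_odd -!big_split /=.
  apply: eq_big_nat => j /andP[j1 _].
  rewrite mulrN1z mulN1r q2 /odd_ratio exprM -/y -/Z.
  set u := y ^+ (2 * j - 1).
  have -> : (y ^+ 2) ^+ (2 * j - 1) = u * u by rewrite -expr2 exprAC.
  have uu : 1 - Z * u \is a GRing.unit.
    rewrite /u /y -exprM -mulNr -mulrNz; apply: signed_unit; rewrite muln_gt0 c0; lia.
  have -> : (1 - u * u) ^+ 2 = (1 - u * u) * (1 + Z * u) * (1 - Z * u).
    by ring: ZZ.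
  move: (1 - Z * u) (1 - Z * u)^-1 (mulVr uu) => B I IB.
  by ring: IB.
rewrite [X in fps_eqm _ _ X]big_split /= [X in fps_eqm _ _ X]mulrC.
apply: fps_eqmM => //.
rewrite (@qpoch_split _ _ M) ?leq_pmull //.
have -> : \prod_(1 <= j < M.+1) (1 - y ^+ (2 * j)) = qpoch (y ^+ 2) M.
  by apply: eq_bigr => j _; rewrite exprM.
rewrite -[X in fps_eqm _ _ X]mulr1; apply: fps_eqmM => //.
apply: (@fps_eqm_leq _ _ (c * 2 * M.+1)); first by rewrite leq_pmull; lia.
by rewrite /y -exprM; apply: fps_is1_qpoch_tail; lia.
Qed.

Lemma schur9_factorE r j : (0 < j)%N ->
  schur9_factor r j = (odd_ratio 1 1 j * odd_ratio (-1) 9 j) ^+ r.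
Proof.
move=> j0; rewrite /schur9_factor /odd_ratio.
have l1 : (0 < 1 * (2 * j - 1))%N by lia.
have l9 : (0 < 9 * (2 * j - 1))%N by lia.
have := (signed_unit 1 l9, signed_unit (-1) l1).
rewrite mul1n !mulrN1z !mulr1z !mulN1r !mul1r opprK => -[u9 u1].
by rewrite (invrM (unitrX r u9) (unitrX r u1)) -!exprVn -!exprMn; congr (_ ^+ _); ring.
Qed.

Lemma schur9_gf_theta r :
  schur9_gf r * (theta (-1) 2 * theta (-1) 18) ^+ r =
  (theta 1 1 * theta (-1) 9) ^+ r.
Proof.
apply: fps_eqmP => M; apply: (@fps_eqm_leq _ _ M.+1) => //.
have gfE : fps_eqm M.+1 (schur9_gf r)
    (\prod_(1 <= j < M.+1) (odd_ratio 1 1 j * odd_ratio (-1) 9 j) ^+ r).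
  move=> n; rewrite ltnS => leM; rewrite [LHS](schur9_gf_limit r leM).
  congr (fcoef _ n); apply: eq_big_nat => j /andP[j0 _]; exact: schur9_factorE.
apply: (fps_eqm_trans (fps_eqmM gfE (@fps_eqm_refl _ _ _))).
rewrite prodrXl -exprMn big_split /= mulrACA; apply: fps_eqmX.
by apply: fps_eqmM; [apply: (@theta_ratio 1 1) | apply: (@theta_ratio (-1) 9)].
Qed.

(** * Powers modulo 16 and squares modulo 2 *)

Lemma pow8_mod16 (R : comNzRingType) (x : R) m :
  exists y, (1 + 2 * x) ^+ (8 * m) = 1 + 16 * y.
Proof.
have [y yE] : exists y, (1 + 2 * x) ^+ 8 = 1 + 16 * y.
  (* The coefficients are C(8,k) 2^k / 16. *)
  by exists (x + 7 * x ^+ 2 + 28 * x ^+ 3 + 70 * x ^+ 4 + 112 * x ^+ 5 +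
             112 * x ^+ 6 + 64 * x ^+ 7 + 16 * x ^+ 8); ring.
rewrite exprM yE; elim: m => [|m [z IHm]]; first by exists 0; rewrite expr0; ring.
by exists (y + z + 16 * y * z); rewrite exprS IHm; ring.
Qed.

Definition fps_diag_sqr (a : fps int) : fps int :=
  Fps (fun n => \sum_(i < n.+1 | (i + i)%N == n) fcoef a i * fcoef a i).

(** Off-diagonal products of coefficients occur twice in a square; [h] collects one of each pair. *)
Lemma fps_sqr_mod2 (a : fps int) : exists h, a * a = fps_diag_sqr a + 2 * h.
Proof.
exists (Fps (fun n => \sum_(i < n.+1 | (i < n - i)%N) fcoef a i * fcoef a (n - i))).
apply: fpsP => n; rewrite mulr_natl fcoefD fcoefMn fcoefM.
rewrite (bigID (fun i : 'I_n.+1 => (i + i == n)%N)) /=; congr (_ + _).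
  apply: eq_bigr => i /eqP eqn; congr (_ * fcoef _ _); lia.
rewrite (bigID (fun i : 'I_n.+1 => (i < n - i)%N)) /= mulr2n; congr (_ + _).
  by apply: eq_bigl => i; lia.
rewrite (reindex_inj rev_ord_inj) /=; apply: eq_big => i.
  by have := ltn_ord i; lia.
move=> _; rewrite mulrC subSS; congr (fcoef _ _ * _).
by have := ltn_ord i; lia.
Qed.

(** * Residues of exponents modulo 6 *)

Section Mod6Support.
Implicit Types (a b : fps int) (l : seq nat).

Definition supp6 l a := forall n, (n %% 6)%N \notin l -> fcoef a n = 0.

Lemma supp6D l a b : supp6 l a -> supp6 l b -> supp6 l (a + b).
Proof. by move=> al bl n nl; rewrite fcoefD al ?bl. Qed.

Lemma supp6N l a : supp6 l a -> supp6 l (- a).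
Proof. by move=> al n nl; rewrite fcoefN al ?oppr0. Qed.

Lemma supp6_natl l k a : supp6 l a -> supp6 l (k%:R * a).
Proof. by move=> al n nl; rewrite mulr_natl fcoefMn al ?mul0rn. Qed.

Lemma supp6M l1 l2 l a b :
  all (fun i => all (fun j => ((i + j) %% 6)%N \in l) l2) l1 ->
  supp6 l1 a -> supp6 l2 b -> supp6 l (a * b).
Proof.
move=> /allP l12 al bl n nl; rewrite fcoefM big1 // => i _.
have [il1|/al->] := boolP ((i %% 6)%N \in l1); last by rewrite mul0r.
have [jl2|/bl->] := boolP (((n - i) %% 6)%N \in l2); last by rewrite mulr0.
have /allP/(_ _ jl2) := l12 _ il1.
by rewrite modnDm subnKC ?(negbTE nl) // -ltnS.
Qed.

Lemma supp6_sub l1 l2 a : all (mem l2) l1 -> supp6 l1 a -> supp6 l2 a.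
Proof.
by move=> /allP l12 al n nl; apply: al; apply: contraNN nl; apply: l12.
Qed.

Lemma supp6_1 l : 0%N \in l -> supp6 l 1.
Proof. by move=> l0 [|n] nl; rewrite fcoef1 //; rewrite mod0n l0 in nl. Qed.

(** Chinese remainders: 3 and 4 are the idempotents modulo 6, and k^2 is 0 or 1 modulo 2 and modulo
    3. *)
Lemma sqr_mod6 k : k ^ 2 = 3 * odd k + 4 * ~~ (3 %| k)%N %[mod 6].
Proof.
have -> : odd k = odd (k %% 6) by lia.
have -> : (3 %| k)%N = (3 %| k %% 6)%N by lia.
rewrite -modnXm.
by case: (k %% 6)%N (ltn_pmod k (isT : 0 < 6)%N) => [|[|[|[|[|[|]]]]]].
Qed.

Lemma supp6_theta_tail l c w :
  (forall k, w k != 0 ->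
     ((c * (3 * odd k + 4 * ~~ (3 %| k)%N)) %% 6)%N \in l) ->
  supp6 l (theta_tail c w).
Proof.
move=> wl n nl; rewrite fcoef_theta_tail big1 // => k /eqP eqn.
apply/eqP; apply: contraNT nl => /wl.
by rewrite -modnMmr -sqr_mod6 modnMmr eqn.
Qed.

End Mod6Support.

(** * Dissection of the theta series and expansion modulo 16 *)

Section ThetaTail.
Variable c : nat.
Hypothesis c0 : (0 < c)%N.

Lemma fcoef_theta_tail_sqr w k : (0 < k)%N ->
  fcoef (theta_tail c w) (c * k ^ 2) = w k.
Proof.
move=> k0; rewrite fcoef_theta_tail big_mkcond big_nat.
have ltk : (k < (c * k ^ 2).+1)%N by rewrite expnS expn1; nia.
rewrite -big_nat (bigD1_seq k) ?mem_index_iota ?iota_uniq ?k0 //= eqxx.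
rewrite big1_seq ?addr0 // => j /andP[neq _].
by rewrite eqn_pmul2l // eqn_exp2r // (negbTE neq).
Qed.

Lemma fcoef_theta_tail_eq0 w n :
  (forall k, (0 < k)%N -> n <> (c * k ^ 2)%N) -> fcoef (theta_tail c w) n = 0.
Proof.
move=> nsq; rewrite fcoef_theta_tail big_nat_cond big1 // => k.
by case/andP=> /andP[k0 _] /eqP /esym /(nsq _ k0).
Qed.

End ThetaTail.

Lemma theta_tailD c w1 w2 :
  theta_tail c (fun k => w1 k + w2 k) = theta_tail c w1 + theta_tail c w2.
Proof. by apply: fpsP => n; rewrite fcoefD !fcoef_theta_tail big_split. Qed.

Lemma theta_tailN c w : theta_tail c (fun k => - w k) = - theta_tail c w.
Proof. by apply: fpsP => n; rewrite fcoefN !fcoef_theta_tail sumrN. Qed.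

Lemma eq_theta_tail c w1 w2 : w1 =1 w2 -> theta_tail c w1 = theta_tail c w2.
Proof.
by move=> w12; apply: fpsP => n; rewrite !fcoef_theta_tail; apply: eq_bigr.
Qed.

(** As 9 k^2 = (3k)^2, such a series can be added to one over all squares by adding weights. *)
Lemma theta_tail_mul3 w :
  theta_tail 9 w = theta_tail 1 (fun k => if (3 %| k)%N then w (k %/ 3)%N else 0).
Proof.
apply: fpsP => n.
have [/existsP[k /andP[k0 /eqP->]]|/existsPn nsq] :=
    boolP [exists k : 'I_n.+1, (0 < k)%N && (n == 1 * k ^ 2)%N].
  rewrite fcoef_theta_tail_sqr //; case: ifPn => [/dvdnP[l kl]|k3].
    rewrite kl mulnK // in k0 *.
    have -> : (1 * (l * 3) ^ 2 = 9 * l ^ 2)%N by rewrite !expnS; lia.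
    by apply: fcoef_theta_tail_sqr => //; lia.
  apply: fcoef_theta_tail_eq0 => l l0 eqkl; case/negP: k3; apply/dvdnP; exists l.
  apply/eqP; rewrite -(eqn_exp2r _ _ (isT : 0 < 2)%N); apply/eqP.
  by move: eqkl; rewrite mul1n expnMn mulnC.
have nsq' k : (0 < k)%N -> n <> (1 * k ^ 2)%N.
  move=> k0 nk; have ltk : (k < n.+1)%N by rewrite nk expnS expn1; nia.
  by have := nsq (Ordinal ltk); rewrite /= k0 -nk eqxx.
rewrite !fcoef_theta_tail_eq0 // => k k0.
have -> : (9 * k ^ 2 = 1 * (3 * k) ^ 2)%N by rewrite !expnS; lia.
by apply: nsq'; lia.
Qed.

(* The exponents of the four series that follow are 0, 3, 4 and 1 modulo 6. *)
Definition tail9_even := theta_tail 9 (fun k => (~~ odd k)%:R).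
Definition tail9_odd := theta_tail 9 (fun k => (odd k)%:R).
Definition tail1_even := theta_tail 1 (fun k => (~~ odd k && ~~ (3 %| k)%N)%:R).
Definition tail1_odd := theta_tail 1 (fun k => (odd k && ~~ (3 %| k)%N)%:R).

Lemma theta1_split : theta 1 1 = 1 + 2 * (tail9_even + tail9_odd + tail1_even + tail1_odd).
Proof.
rewrite mulr_natl; congr (1 + _ *+ 2).
rewrite /tail9_even /tail9_odd !theta_tail_mul3 -!theta_tailD.
apply: eq_theta_tail => k; rewrite expr1n.
have [k3|k3] := boolP (3 %| k)%N; last by rewrite !andbT; case: (odd k).
have -> : odd (k %/ 3) = odd k by lia.
by rewrite !andbF; case: (odd k).
Qed.

Lemma theta9_split : theta (-1) 9 = 1 + 2 * (tail9_even - tail9_odd).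
Proof.
rewrite mulr_natl; congr (1 + _ *+ 2).
rewrite /tail9_even /tail9_odd -theta_tailN -theta_tailD.
by apply: eq_theta_tail => k; rewrite -signr_odd; case: (odd k).
Qed.

(** Modulo 6 the exponents are 0 in [tail2_0] and [tail18], and 2 in [tail2_2]. *)
Definition tail2_0 := theta_tail 2 (fun k => if (3 %| k)%N then (-1) ^+ k else 0).
Definition tail2_2 := theta_tail 2 (fun k => if (3 %| k)%N then 0 else (-1) ^+ k).
Definition tail18 := theta_tail 18 (fun k => (-1) ^+ k).

Lemma theta2_split : theta (-1) 2 = 1 + 2 * (tail2_0 + tail2_2).
Proof.
rewrite mulr_natl; congr (1 + _ *+ 2); rewrite -theta_tailD.
by apply: eq_theta_tail => k; case: ifP; rewrite ?addr0 ?add0r.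
Qed.

Lemma theta18_split : theta (-1) 18 = 1 + 2 * tail18.
Proof. by rewrite mulr_natl. Qed.

Lemma supp6_9_even : supp6 [:: 0%N] tail9_even.
Proof. by apply: supp6_theta_tail => k; case: (odd k) => //; case: (3 %| k)%N. Qed.

Lemma supp6_9_odd : supp6 [:: 3] tail9_odd.
Proof. by apply: supp6_theta_tail => k; case: (odd k) => //; case: (3 %| k)%N. Qed.

Lemma supp6_1_even : supp6 [:: 4] tail1_even.
Proof. by apply: supp6_theta_tail => k; case: (odd k) => //; case: (3 %| k)%N. Qed.

Lemma supp6_1_odd : supp6 [:: 1%N] tail1_odd.
Proof. by apply: supp6_theta_tail => k; case: (odd k) => //; case: (3 %| k)%N. Qed.

Lemma supp6_2_0 : supp6 [:: 0%N] tail2_0.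
Proof. by apply: supp6_theta_tail => k; case: (3 %| k)%N => //; case: (odd k). Qed.

Lemma supp6_2_2 : supp6 [:: 2] tail2_2.
Proof. by apply: supp6_theta_tail => k; case: (3 %| k)%N => //; case: (odd k). Qed.

Lemma supp6_18 : supp6 [:: 0%N] tail18.
Proof. by apply: supp6_theta_tail => k _; case: (3 %| k)%N; case: (odd k). Qed.

(* The three leading terms have their exponents in {0,2,4}, {1,3} and {1} + {4} modulo 6
   when the variables are the series above: e = 0, o = 3, r = 4, p = 1, s0 = 0, s2 = 2,
   t = 0 and d = 4. *)
Lemma mod16_expansion (K : comNzRingType) (g e o r p s0 s2 t v d h a b : K) :
  v = (s0 + s2) + t + 2 * (s0 + s2) * t ->
  s2 * s2 = d + 2 * h ->
  g * ((1 + 2 * v) * (1 + 16 * a)) =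
    (1 + 2 * (e + o + r + p)) * (1 + 2 * (e - o)) * (1 + 16 * b) ->
  exists z, g =
    ((1 + 2 * e) * (1 + 2 * e) + 2 * (r * (1 + 2 * e)) - 4 * (o * o) - 4 * (o * p)) *
      (1 - 2 * v + 4 * (v * v) - 8 * (v * v * v)) +
    (p * (1 + 2 * e) - 2 * (o * r)) *
      (2 * (1 - 2 * v) + 8 * (s0 * s0 + t * t)) +
    8 * (p * d) + 16 * z.
Proof.
move=> vE sE gE.
(* [W] inverts 1 + 2v modulo 16, because (1 + 2v) W = 1 - 16 v^4. *)
set W := 1 - 2 * v + 4 * (v * v) - 8 * (v * v * v).
set y := (1 + 2 * (e + o + r + p)) * (1 + 2 * (e - o)) in gE.
have gW : g = y * W + 16 * ((y * b - g * (1 + 2 * v) * a) * W + g * v ^+ 4).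
  have gV : g * (1 + 2 * v) = y + 16 * (y * b - g * (1 + 2 * v) * a).
    transitivity (g * ((1 + 2 * v) * (1 + 16 * a)) - 16 * (g * (1 + 2 * v) * a)).
      by ring.
    by rewrite gE; ring.
  transitivity (g * (1 + 2 * v) * W + 16 * (g * v ^+ 4)); first by rewrite /W; ring.
  by rewrite {1}gV; ring.
(* For the intended series, 2u is the part of [y] in class 1 modulo 6; class 3 cancels and the rest
   is in classes 0 and 4. In 2uW the cubic term of [W] vanishes modulo 16, and v^2 matters only
   modulo 2. *)
set u := p * (1 + 2 * e) - 2 * (o * r).
pose w := (s0 + s2) * t.
(* Half of what v^2 contains besides the squares of s0, s2 and t. *)
pose k := s0 * s2 + (s0 + s2) * t + 2 * (s0 + s2 + t) * w + 2 * w * w.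
have vvE : v * v = s0 * s0 + t * t + d + 2 * (h + k).
  transitivity (s0 * s0 + t * t + s2 * s2 + 2 * k); last by rewrite sE; ring.
  by rewrite vE /k /w; ring.
exists ((y * b - g * (1 + 2 * v) * a) * W + g * v ^+ 4 - u * (v * v * v) + u * (h + k)
        + (p * e - o * r) * d).
rewrite {1}gW [LHS](_ : _ = y * W - 2 * u * W + 2 * u * (1 - 2 * v) + 8 * u * (v * v) +
  16 * ((y * b - g * (1 + 2 * v) * a) * W + g * v ^+ 4 - u * (v * v * v))); last first.
  by rewrite /W; ring.
rewrite {1}vvE.
have -> : y = (1 + 2 * e) * (1 + 2 * e) + 2 * (r * (1 + 2 * e)) - 4 * (o * o) -
   4 * (o * p) + 2 * u by rewrite /y /u; ring.
rewrite /u; ring.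
Qed.

(** * The coefficient at exponents 5 modulo 6 *)

Definition sum_two_squares N := exists a b, N = (a ^ 2 + b ^ 2)%N.

(** The diagonal square doubles the exponents 2 l^2 of [tail2_2], so the exponents of the product
    are k^2 + (2l)^2. *)
Lemma fcoef_tail1_odd_diag N : ~ sum_two_squares N ->
  fcoef (tail1_odd * fps_diag_sqr tail2_2) N = 0.
Proof.
move=> nsq; rewrite fcoefM big1 // => i _.
have [/existsP[k /eqP iE]|/existsPn nk] := boolP [exists k : 'I_N.+1, (i == k ^ 2 :> nat)%N]; last first.
  rewrite [fcoef tail1_odd _]fcoef_theta_tail_eq0 ?mul0r // => k k0 iE.
  have ltk : (k < N.+1)%N by have := ltn_ord i; rewrite iE expnS expn1; nia.
  by have := nk (Ordinal ltk); rewrite /= iE mul1n eqxx.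
rewrite [X in _ * X]big1 ?mulr0 // => j /eqP jE.
rewrite [fcoef tail2_2 _]fcoef_theta_tail_eq0 ?mul0r // => l l0 lE.
apply: nsq; exists k, (2 * l)%N; have := ltn_ord i.
by rewrite expnMn -iE; lia.
Qed.

Lemma schur9_mod16 m N : (N %% 6 = 5)%N -> ~ sum_two_squares N ->
  exists z, schur9_overpartitions (8 * m + 1) N = 16 * z.
Proof.
move=> N5 nsq.
pose v := (tail2_0 + tail2_2) + tail18 + 2 * (tail2_0 + tail2_2) * tail18.
pose y := tail9_even + tail9_odd + tail1_even + tail1_odd + (tail9_even - tail9_odd) +
  2 * (tail9_even + tail9_odd + tail1_even + tail1_odd) * (tail9_even - tail9_odd).
have thV : theta (-1) 2 * theta (-1) 18 = 1 + 2 * v.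
  by rewrite theta2_split theta18_split /v; move: tail2_0 tail2_2 tail18 => *; ring.
have thY : theta 1 1 * theta (-1) 9 = 1 + 2 * y.
  rewrite theta1_split theta9_split /y.
  by move: tail9_even tail9_odd tail1_even tail1_odd => *; ring.
have := schur9_gf_theta (8 * m + 1).
have [a aE] := pow8_mod16 v m; have [b bE] := pow8_mod16 y m.
rewrite !(exprD _ (8 * m) 1) !expr1 thV {1}thY aE bE [X in _ * X]mulrC [RHS]mulrC.
rewrite theta1_split theta9_split.
have [h hE] := fps_sqr_mod2 tail2_2.
move=> /(mod16_expansion (erefl v) hE)[z gE].
exists (fcoef z N); rewrite /schur9_overpartitions gE !fcoefD.
have supp0 l : 5 \notin l -> forall c, supp6 l c -> fcoef c N = 0.
  by move=> l5 c -> //; rewrite N5.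
have supp6s : supp6 [:: 0%N; 2] (tail2_0 + tail2_2).
  by apply: supp6D; [apply: supp6_sub supp6_2_0 | apply: supp6_sub supp6_2_2].
have supp6v : supp6 [:: 0%N; 2] v.
  apply: supp6D; first by apply: supp6D => //; apply: supp6_sub supp6_18.
  apply: supp6M (supp6_18); last exact: supp6_natl supp6s.
  by [].
pose ev := [:: 0%N; 2; 4].
have evM c1 c2 : supp6 ev c1 -> supp6 ev c2 -> supp6 ev (c1 * c2).
  exact: supp6M.
have evv : supp6 ev v by apply: supp6_sub supp6v.
have ev1 : supp6 ev 1 by apply: supp6_1.
have e1 : supp6 [:: 0%N] (1 + 2 * tail9_even).
  by apply: supp6D; [apply: supp6_1 | apply: supp6_natl supp6_9_even].
have ee : supp6 ev (1 + 2 * tail9_even) by apply: supp6_sub e1.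
(* First term: all exponents are even, since [tail9_odd] and [tail1_odd] occur only in products of
   two odd series. *)
rewrite (supp0 ev) //; last first.
  apply: (evM).
    do ![apply: supp6D | apply: supp6N | apply: supp6_natl | apply: (evM _ _ ee ee)].
    - by apply: (evM) => //; apply: supp6_sub supp6_1_even.
    - exact: supp6M supp6_9_odd supp6_9_odd.
    - exact: supp6M supp6_9_odd supp6_1_odd.
  by do ![exact: (ev1) | exact: (evv) | apply: supp6D | apply: supp6N | apply: supp6_natl | apply: (evM)].
(* Second term: class 1 times classes 0 and 2 never reaches class 5. *)
rewrite (supp0 [:: 1%N; 3]) //; last first.
  apply: (@supp6M [:: 1%N] [:: 0%N; 2]) => //.
    apply: supp6D; first exact: supp6M supp6_1_odd e1.
    by apply/supp6N/supp6_natl; exact: supp6M supp6_9_odd supp6_1_even.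
  apply: supp6D; apply: supp6_natl.
    by apply: supp6D; [apply: supp6_1 | apply/supp6N/supp6_natl].
  apply: (@supp6_sub [:: 0%N]) => //.
  by apply: supp6D; [apply: supp6M supp6_2_0 supp6_2_0 | apply: supp6M supp6_18 supp6_18].
by rewrite !mulr_natl !fcoefMn fcoef_tail1_odd_diag // mul0rn !add0r.
Qed.

(** * Sums of two squares and the prime p *)

(** If b were nonzero modulo p, then (3a/b)^2 = -9 in the field of p elements. *)
Lemma legendre_m9_sum_sqr p a b : prime p -> legendre (-9) p = -1 ->
  (p %| a ^ 2 + b ^ 2)%N -> (p %| b)%N.
Proof.
move=> p_pr; rewrite /legendre; case: ifP => // _; case: ifP => // /existsPn nsq _.
have pchar := pchar_Fp p_pr.
rewrite !(dvdn_pcharf pchar) natrD !natrX => /eqP ab0.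
apply/negPn/negP => b0; case/negP: (nsq (3 * a%:R / b%:R)); apply/eqP.
rewrite !exprMn exprVn (_ : a%:R ^+ 2 = - b%:R ^+ 2); last first.
  by apply/eqP; rewrite -addr_eq0 ab0.
by rewrite mulrN mulNr mulfK ?expf_neq0 // -natrX mulrNz.
Qed.

(** Descent: a sum of two squares divisible by p has both terms divisible by p, so dividing it by
    p^2 leaves a sum of two squares. An odd power of p thus ends at a single p, which would force p
    to divide [N]. *)
Lemma not_sum_two_squares p k N : prime p -> legendre (-9) p = -1 ->
  ~~ (p %| N)%N -> ~ sum_two_squares (p ^ (2 * k + 1) * N).
Proof.
move=> p_pr leg pN.
have p0 := prime_gt0 p_pr.
have descent M : sum_two_squares (p * M) -> exists2 M', M = (p * M')%N & sum_two_squares M'.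
  case=> a [b abE].
  have /dvdnP[b' bE] : (p %| b)%N.
    by apply: (@legendre_m9_sum_sqr p a) => //; rewrite -abE dvdn_mulr.
  have /dvdnP[a' aE] : (p %| a)%N.
    by apply: (@legendre_m9_sum_sqr p b) => //; rewrite addnC -abE dvdn_mulr.
  exists (a' ^ 2 + b' ^ 2)%N; last by exists a', b'.
  apply/eqP; rewrite -(eqn_pmul2l p0) abE aE bE !expnMn -mulnDl.
  by rewrite mulnC expnS expn1 mulnA.
elim: k => [|k IHk].
  by rewrite muln0 expn1 => /descent[M NE _]; rewrite NE dvdn_mulr in pN.
have -> : (2 * k.+1 + 1 = (2 * k + 1).+2)%N by lia.
rewrite 2!expnS -!mulnA => /descent[M + Msq] => /eqP.
by rewrite eqn_pmul2l // => /eqP ME; apply: IHk; rewrite ME.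
Qed.

Theorem theorem3p8 (p : nat) (p_prime : prime p) (p_ge5 : (5 <= p)%N)
    (leg : legendre (-9) p = -1) (m alpha n : nat) (i : nat)
    (i_range : (1 <= i <= p - 1)%N) :
  (schur9_overpartitions (8 * m + 1)
     (12 * p ^ (2 * alpha + 2) * n + (12 * i + 5 * p) * p ^ (2 * alpha + 1))%N
   = 0 %[mod 16])%Z.
Proof.
set N := (X in schur9_overpartitions _ X).
have p2 : (p ^ 2 %% 6 = 1)%N.
  rewrite sqr_mod6.
  have /negPf -> : ~~ (3 %| p)%N by rewrite dvdn_prime2 //; lia.
  by case: (even_prime p_prime) => [p2|->]; first by rewrite p2 in p_ge5.
(* The cofactor of the odd power of p is 12 i modulo p, which is nonzero as p divides neither 12 nor
   i. *)
have NE : N = (p ^ (2 * alpha + 1) * (p * (12 * n + 5) + 12 * i))%N.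
  rewrite /N (_ : 2 * alpha + 2 = (2 * alpha + 1).+1)%N ?expnS; last by lia.
  by rewrite mulnDr mulnDl; lia.
(* Modulo 6 only 5 p^(2 alpha + 2) remains of [N]. *)
have N5 : (N %% 6 = 5)%N.
  have : (p ^ (2 * alpha + 2) %% 6 = 1)%N.
    rewrite (_ : 2 * alpha + 2 = 2 * alpha.+1)%N; last by lia.
    by rewrite expnM -modnXm p2 exp1n.
  rewrite /N (_ : 2 * alpha + 2 = (2 * alpha + 1).+1)%N ?expnS; last by lia.
  lia.
have nsq : ~ sum_two_squares N.
  rewrite NE; apply: not_sum_two_squares => //.
  have p12 : ~~ (p %| 12)%N.
    by rewrite -[12%N]/(2 * 2 * 3)%N !Euclid_dvdM // !dvdn_prime2 //; lia.
  rewrite (dvdn_addr _ (dvdn_mulr _ (dvdnn p))) Euclid_dvdM // negb_or p12 gtnNdvd //; lia.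
by have [z ->] := schur9_mod16 m N5 nsq; rewrite modzMr mod0z.
Qed.
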